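(* Let $(M,\tau,\ell)$ be a forward metric spacetime and let $\Gamma\subset\mathrm{LCC}([0,1];M)$ be such that: (i) for some Borel $\mathscr D\subset[0,1]$ with Lebesgue measure $1$ and $0\in\mathscr D$, the set $\{\gamma_t:\gamma\in\Gamma\}$ is relatively compact in $M$ for each $t\in\mathscr D$; (ii) there is a compact set $K\subset M$ such that for every $\gamma\in\Gamma$ there is $x\in K$ with $\gamma_1\le x$. Then $\Gamma$ is $\mathsf D$-relatively compact. If moreover the topology $\tau$ is locally causally convex, then the same conclusion holds with (i) weakened to: (i') for some dense $\tilde{\mathscr D}\subset[0,1]$ with $0\in\tilde{\mathscr D}$, the set $\{\gamma_t:\gamma\in\Gamma\}$ is relatively compact in $M$ for each $t\in\tilde{\mathscr D}$.
   Context: A time separation on a set $M$ is a map $\ell:M\times M\to\{-\infty\}\cup[0,+\infty]$ with $\ell(x,x)=0$ and $\min\{\ell(x,y)+\ell(y,z),\ell(y,z)+\ell(x,y)\}\le\ell(x,z)$, where $\pm\infty+z=\pm\infty$ for every $z\in[-\infty,\infty]$; write $x\le y$ if $\ell(x,y)\ge0$. $(M,\tau,\ell)$ is a forward metric spacetime if $\tau$ is a Polish topology, $\le$ is a partial order, $\{\ell\ge0\}$ is closed in $M^2$, and every sequence with $x_n\le x_{n+1}\le\bar x$ for all $n$ and some $\bar x\in M$ has a $\tau$-limit. $A\subset M$ is causally convex if $x,y\in A$, $x\le z\le y$ imply $z\in A$; $\tau$ is locally causally convex if every point has a neighbourhood basis made of causally convex sets. $\mathrm{LCC}([0,1];M)$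 is the set of left-continuous maps $\gamma:[0,1]\to M$ (i.e. $\gamma_t=\lim_{s\uparrow t}\gamma_s$ for $t\in(0,1]$) which are causal ($s\le t$ implies $\gamma_s\le\gamma_t$), with the distance $\mathsf D(\gamma,\eta)=\mathsf d(\gamma_0,\eta_0)+\int_0^1\mathsf d(\gamma_t,\eta_t)\,\mathrm dt$, where $\mathsf d$ is a fixed bounded complete distance inducing $\tau$. *)

(* Defs.v *)
From HB Require Import structures.
From mathcomp Require Import all_boot all_order all_algebra.
From mathcomp Require Import mathcomp_extra boolp classical_sets functions.
From mathcomp Require Import cardinality reals ereal topology normedtype.
From mathcomp Require Import sequences realfun measure lebesgue_measure.
From mathcomp Require Import measurable_realfun lebesgue_integral.
From mathcomp Require Import ring lra.

Set Implicit Arguments.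
Unset Strict Implicit.
Unset Printing Implicit Defensive.

Import Order.TTheory GRing.Theory Num.Theory.
Import numFieldNormedType.Exports metricType_numDomainType.

Local Open Scope classical_set_scope.
Local Open Scope ring_scope.

Definition separable (T : topologicalType) : Prop :=
  exists2 A : set T, countable A & dense A.

Definition complete_metric (R : realType) (N : metricType R) : Prop :=
  forall F : set_system N, ProperFilter F -> cauchy F ->
    exists x : N, F --> x.

Definition bounded_metric (R : realType) (N : metricType R) : Prop :=
  exists C : R, forall x y : N, mdist x y <= C.

Definition completely_metrizable (R : realType) (T : topologicalType) : Prop :=
  exists (N : metricType R) (f : T -> N) (g : N -> T),
    [/\ cancel f g, cancel g f, continuous f, continuous g
      & complete_metric N].

Definition polish (R : realType) (T : topologicalType) : Prop :=
  separable T /\ completely_metrizable R T.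

(* Addition with the convention [+oo + z = +oo] and [-oo + z = -oo] for every
   [z]; it is not commutative, and differs from [adde] at [+oo + -oo]. *)
Definition ladde (R : realType) (x y : \bar R) : \bar R :=
  (if x is r%:E then r%:E + y else x)%E.

Definition time_separation (R : realType) (M : Type)
    (ell : M -> M -> \bar R) : Prop :=
  [/\ forall x y, (ell x y = -oo \/ 0 <= ell x y)%E,
      forall x, ell x x = 0%E
    & forall x y z,
        (Order.min (ladde (ell x y) (ell y z)) (ladde (ell y z) (ell x y))
           <= ell x z)%E].

Definition causal_le (R : realType) (M : Type) (ell : M -> M -> \bar R)
    (x y : M) : Prop := (0 <= ell x y)%E.

Definition causally_convex (R : realType) (M : Type) (ell : M -> M -> \bar R)
    (A : set M) : Prop :=
  forall x y z, A x -> A y -> causal_le ell x z -> causal_le ell z y -> A z.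

Definition locally_causally_convex (R : realType) (M : topologicalType)
    (ell : M -> M -> \bar R) : Prop :=
  forall (x : M) (U : set M), nbhs x U ->
    exists V : set M, [/\ nbhs x V, V `<=` U & causally_convex ell V].

Record forward_metric_spacetime (R : realType) (M : topologicalType)
    (ell : M -> M -> \bar R) : Prop := {
  fms_time_separation : time_separation ell;
  fms_polish : polish R M;
  fms_refl : forall x, causal_le ell x x;
  fms_trans : forall x y z,
    causal_le ell x y -> causal_le ell y z -> causal_le ell x z;
  fms_antisym : forall x y, causal_le ell x y -> causal_le ell y x -> x = y;
  fms_closed : closed [set p : M * M | causal_le ell p.1 p.2];
  fms_forward : forall (u : nat -> M) (b : M),
    (forall n, causal_le ell (u n) (u n.+1)) ->
    (forall n, causal_le ell (u n) b) ->
    exists l : M, u @ \oo --> l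
}.

Definition I01 (R : realType) := {t : R | 0 <= t <= 1}.

Section clamp.
Context {R : realType}.
Implicit Types t : R.

Lemma clamp_subproof t : 0 <= Num.max 0 (Num.min t 1) <= 1.
Proof. by rewrite le_max lexx ge_max ler01 ge_min lexx orbT. Qed.

Definition clamp t : I01 R := exist (fun s : R => 0 <= s <= 1) _ (clamp_subproof t).

Lemma clampK t : 0 <= t <= 1 -> \val (clamp t) = t.
Proof. by move=> /andP[t0 t1] /=; rewrite (min_l t1) (max_r t0). Qed.

Lemma clamp_val (t : I01 R) : clamp (\val t) = t.
Proof. by apply/val_inj/clampK; case: t. Qed.

End clamp.

(* The bound on the metric is a parameter of the type because the distance put
   on it below needs it. *)
Record LCC (R : realType) (M : metricType R) (ell : M -> M -> \bar R)
    (Mbd : bounded_metric M) := MkLCC {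
  lcc_fun :> I01 R -> M;
  lcc_causal : forall s t : I01 R,
    \val s <= \val t -> causal_le ell (lcc_fun s) (lcc_fun t);
  lcc_left_continuous : forall t : I01 R, 0 < \val t ->
    lcc_fun (clamp s) @[s --> (\val t)^'-] --> lcc_fun t
}.

HB.instance Definition _ R M ell Mbd := gen_eqMixin (@LCC R M ell Mbd).
HB.instance Definition _ R M ell Mbd := gen_choiceMixin (@LCC R M ell Mbd).

Definition lcc_dist (R : realType) (M : metricType R) (ell : M -> M -> \bar R)
    (Mbd : bounded_metric M) (g h : LCC ell Mbd) : R :=
  mdist (g (clamp 0)) (h (clamp 0)) +
  \int[lebesgue_measure]_(t in `[0, 1]) mdist (g (clamp t)) (h (clamp t)).

Section left_continuous_measurable.
Context {R : realType}.

Lemma measurable_comp_ceil (c : R) (F : int -> R) : 0 < c ->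
  measurable_fun setT (fun t : R => F (Num.ceil (c * t))).
Proof.
move=> c0 _ Y mY; rewrite setTI.
pose A (k : int) : set R :=
  if pselect (Y (F k)) then `]((k - 1)%:~R / c), (k%:~R / c)]%classic else set0.
pose B (n : nat) : set R := if unpickle n is Some k then A k else set0.
suff -> : (fun t : R => F (Num.ceil (c * t))) @^-1` Y = \bigcup_n B n.
  apply: bigcup_measurable => n _; rewrite /B; case: unpickle => // k.
  by rewrite /A; case: pselect => /= _; [exact: measurable_itv|exact: measurable0].
apply/seteqP; split=> [t /= Yt|t [n _]].
  exists (pickle (Num.ceil (c * t))) => //; rewrite /B pickleK.
  rewrite /A; case: pselect => //= _; rewrite in_itv/= ltr_pdivrMr// ler_pdivlMr//.
  by rewrite mulrC ceil_itv.
rewrite /B; case: unpickle => // k; rewrite /A; case: pselect => //= Yk.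
rewrite in_itv/= ltr_pdivrMr// ler_pdivlMr// mulrC => kt.
by rewrite (ceil_def kt).
Qed.

Lemma left_continuous_measurable (f : R -> R) :
  (forall t, f s @[s --> t^'-] --> f t) -> measurable_fun setT f.
Proof.
move=> fl.
pose s n (t : R) : R := (Num.ceil (n.+1%:R * t) - 1)%:~R / n.+1%:R.
apply: (@measurable_fun_cvg _ _ _ _ (fun n t => f (s n t))).
  move=> n.
  exact: (@measurable_comp_ceil n.+1%:R (fun k => f ((k - 1)%:~R / n.+1%:R))).
move=> t _; have /cvg_at_leftP := fl t; apply.
have st n : t - n.+1%:R^-1 <= s n t < t.
  have n0 : 0 < n.+1%:R :> R by [].
  have /andP[h1 h2] := ceil_itv (n.+1%:R * t).
  rewrite /s ltr_pdivrMr// (mulrC t) h1 andbT ler_pdivlMr// mulrBl mulVf ?gt_eqF//.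
  by rewrite rmorphB/= lerB// mulrC.
split=> [n|]; first by have /andP[] := st n.
apply: (@squeeze_cvgr _ _ _ _ (fun n => t - n.+1%:R^-1) (fun=> t)).
- by near=> n; have /andP[-> /ltW ->] := st n.
- rewrite -[X in _ --> X]subr0; apply: cvgB; first exact: cvg_cst.
  exact: cvg_harmonic.
- exact: cvg_cst.
Unshelve. all: by end_near. Qed.

End left_continuous_measurable.

Section lcc_metric.
Context {R : realType} {M : metricType R} {ell : M -> M -> \bar R}.
Context {Mbd : bounded_metric M}.
Implicit Types g h k : LCC ell Mbd.
Local Notation mu := (@lebesgue_measure R).

Let delta g h (t : R) : R := mdist (g (clamp t)) (h (clamp t)).

Lemma lcc_clamp_left g (t : R) :
  g (clamp s) @[s --> t^'-] --> g (clamp t).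
Proof.
have cst_left a : (\forall s \near t^'-, clamp s = a) -> clamp t = a ->
    g (clamp s) @[s --> t^'-] --> g (clamp t).
  move=> ca ->; apply/cvgrPdist_lt => e e0; near=> s.
  have -> : clamp s = a by near: s.
  by rewrite mdistxx.
have [t0|t0] := leP t 0.
  apply: (cst_left (clamp 0)); last first.
    apply/val_inj; rewrite [RHS]clampK ?lexx ?ler01//=.
    by rewrite max_l// ge_min t0.
  near=> s; apply/val_inj; rewrite [RHS]clampK ?lexx ?ler01//=.
  rewrite max_l// ge_min; apply/orP; left; apply: le_trans t0.
  by near: s; exact: nbhs_left_le.
have [t1|t1] := leP t 1.
  have := @lcc_left_continuous _ _ _ _ g (clamp t).
  by rewrite clampK ?(ltW t0)//; exact.
apply: (cst_left (clamp 1)); last first.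
  apply/val_inj; rewrite [RHS]clampK ?lexx ?ler01//=.
  by rewrite (min_r (ltW t1)) max_r.
near=> s; apply/val_inj; rewrite [RHS]clampK ?lexx ?ler01//=.
rewrite min_r ?max_r//; near: s; exact: nbhs_left_ge.
Unshelve. all: by end_near. Qed.

Let delta_left g h (t : R) : delta g h s @[s --> t^'-] --> delta g h t.
Proof.
apply/(@cvgrPdist_le _ R^o) => e e0; near=> s.
have gs : mdist (g (clamp t)) (g (clamp s)) < e / 2.
  near: s; have /cvgrPdist_lt := @lcc_clamp_left g t; apply.
  by rewrite divr_gt0.
have hs : mdist (h (clamp t)) (h (clamp s)) < e / 2.
  near: s; have /cvgrPdist_lt := @lcc_clamp_left h t; apply.
  by rewrite divr_gt0.
rewrite /delta.
have := metric_triangle (g (clamp t)) (g (clamp s)) (h (clamp t)).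
have := metric_triangle (g (clamp s)) (h (clamp s)) (h (clamp t)).
have := metric_triangle (g (clamp s)) (g (clamp t)) (h (clamp s)).
have := metric_triangle (g (clamp t)) (h (clamp t)) (h (clamp s)).
rewrite (metric_sym (g (clamp s)) (g (clamp t))).
rewrite (metric_sym (h (clamp s)) (h (clamp t))).
by rewrite ler_norml => *; lra.
Unshelve. all: by end_near. Qed.

Let measurable_delta g h : measurable_fun setT (delta g h).
Proof. by apply: left_continuous_measurable => t; exact: delta_left. Qed.

Let integrable_delta g h : mu.-integrable `[0, 1] (EFin \o delta g h).
Proof.
apply: measurable_bounded_integrable => //.
- by rewrite /= lebesgue_measure_itv/= lte_fin ltr01 -EFinD ltry.
- exact: measurable_funTS (measurable_delta g h).
- case: Mbd => C bd; exists C; split; first exact: num_real.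
  move=> x Cx t _ /=; rewrite ger0_norm ?mdist_ge0//.
  exact: le_trans (bd _ _) (ltW Cx).
Qed.

Lemma lcc_distxx g : lcc_dist g g = 0.
Proof.
rewrite /lcc_dist mdistxx add0r (@eq_Rintegral _ _ _ _ _ (fun=> 0)).
  by rewrite Rintegral_cst// mul0r.
by move=> t _; rewrite mdistxx.
Qed.

Lemma lcc_dist_sym g h : lcc_dist g h = lcc_dist h g.
Proof.
rewrite /lcc_dist metric_sym; congr (_ + _).
by apply: eq_Rintegral => t _; rewrite metric_sym.
Qed.

Lemma lcc_dist_triangle h g k : lcc_dist g k <= lcc_dist g h + lcc_dist h k.
Proof.
rewrite /lcc_dist addrACA lerD ?metric_triangle//.
rewrite -RintegralD//; [|exact: integrable_delta..].
apply: le_Rintegral => //; first exact: integrable_delta.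
  have : mu.-integrable `[0, 1] ((EFin \o delta g h) \+ (EFin \o delta h k))%E.
    by apply: integrableD => //; exact: integrable_delta.
  exact.
by move=> t _; exact: metric_triangle.
Qed.

Lemma lcc_dist_positivity g h : lcc_dist g h = 0 -> g = h.
Proof.
move=> gh0.
have i0 : 0 <= \int[mu]_(t in `[0, 1]) delta g h t.
  by apply: Rintegral_ge0 => t _; exact: mdist_ge0.
have d0 : 0 <= mdist (g (clamp 0)) (h (clamp 0)) by exact: mdist_ge0.
have [gh00 int0] : mdist (g (clamp 0)) (h (clamp 0)) = 0 /\
    \int[mu]_(t in `[0, 1]) delta g h t = 0.
  by move: gh0 => /eqP; rewrite paddr_eq0// => /andP[/eqP ? /eqP ?].
have [N [mN N0 sN]] : ae_eq mu `[0, 1]%classic (EFin \o delta g h) (cst 0%E).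
  apply/ae_eq_integral_abs => //.
    by apply/measurable_EFinP; exact: measurable_funTS (measurable_delta g h).
  have /integrable_fin_num fi := integrable_delta g h.
  under eq_integral do rewrite /= ger0_norm ?mdist_ge0//.
  by rewrite -[LHS]fineK ?fi// -/(Rintegral _ _ _) int0.
suff gh (t : R) : 0 <= t <= 1 -> delta g h t = 0.
  have {}gh : lcc_fun g = lcc_fun h.
    apply/funext => t; apply: mdist_positivity.
    by rewrite -[t]clamp_val; apply: gh; case: t.
  case: g h gh {gh0 i0 d0 gh00 int0 sN} => [g gc gl] [h hc hl] /= gh.
  by subst h; congr MkLCC; exact: Prop_irrelevance.
move=> /andP[]; rewrite le_eqVlt => /predU1P[<- _ //|t0 t1].
apply/eqP; rewrite eq_le mdist_ge0 andbT leNgt; apply/negP => dt.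
have /(@cvgrPdist_lt _ R^o) /(_ _ dt) := @delta_left g h t.
move=> [e /= e0 near_t].
pose a := Num.max 0 (t - e).
have at_ : a < t by rewrite gt_max t0 ltrBlDr ltrDl.
have : (mu `]a, t[%classic <= mu N)%E.
  apply: le_measure; rewrite ?inE//.
  move=> s /=; rewrite in_itv/= gt_max -andbA => /and3P[s0 es st].
  apply: sN => /= st0.
  have [ds] : (delta g h s)%:E = 0%E.
    by apply: st0; rewrite in_itv/= (ltW s0) (le_trans (ltW st) t1).
  have bs : ball_ Num.norm t e s by rewrite /ball_ /= gtr0_norm; lra.
  by have := near_t s bs st; rewrite /= ds /mdist /= sub0r normrN gtr0_norm ?ltxx.
rewrite N0 lebesgue_measure_itv/= lte_fin at_ -EFinD lee_fin.
by rewrite leNgt subr_gt0 at_.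
Qed.

HB.instance Definition _ := isMetric.Build R (LCC ell Mbd)
  lcc_distxx lcc_dist_positivity lcc_dist_sym lcc_dist_triangle.

End lcc_metric.

(* Main.v *)
(* Take an ultrafilter F on Gamma. By compactness g(s) has a limit h(s) along F
   for every s in a countable order-dense subset E of D containing 0; h is
   causal, and bounded above by a limit of points of K dominating the g(1).
   Forward completeness then yields left limits of h along E, which assemble
   into a left-continuous causal path G. Left limits exist everywhere, so h is
   continuous along E at all but countably many t; at such a t, any limit of
   values g(t) is squeezed between h(s) and h(r), s < t < r, hence equals G(t) by
   antisymmetry of the order (local causal convexity gives the same conclusion
   without compactness at t). Dominated convergence finishes the proof. *)

Require Import Defs.
From mathcomp Require Import all_boot all_order all_algebra.
From mathcomp Require Import boolp classical_sets functions filter cardinality.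
From mathcomp Require Import reals ereal topology normedtype.
From mathcomp Require Import sequences measure lebesgue_measure.
From mathcomp Require Import measurable_realfun lebesgue_integral.
From mathcomp Require Import lra.

Set Implicit Arguments.
Unset Strict Implicit.
Unset Printing Implicit Defensive.

Import Order.TTheory GRing.Theory Num.Theory.
Import numFieldNormedType.Exports metricType_numDomainType.

Local Open Scope classical_set_scope.
Local Open Scope ring_scope.

(** * Ultrafilters and compactness, countable order-dense subsets, closedness of the order *)

Lemma ultra_cvg_compact (T : Type) (X : topologicalType) (F : set_system T)
    (f : T -> X) (K : set X) :
  UltraFilter F -> compact K -> F (f @^-1` K) -> exists2 p, K p & f @ F --> p.
Proof.
move=> FU cK FK; have [p [Kp clp]] := cK (f @ F) _ FK.
(* A cluster point of an ultrafilter is a limit: if the preimage of a neighbourhood were not in [F],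
   its complement would be, and [p] could not be a cluster point. *)
exists p => // U Up; have [//|FnU] := in_ultra_setVsetC (f @^-1` U) FU.
by have [x [/=]] := clp (~` U) U FnU Up.
Qed.

(* The closure of [A] need not belong to an ultrafilter containing [A], so a
   filter on the closure is first thickened to one that meets [A]. *)
Lemma precompact_ultra (R : realType) (X : metricType R) (A : set X) :
  (forall F : set_system X, UltraFilter F -> F A -> exists p : X, F --> p) ->
  precompact A.
Proof.
move=> Acvg; rewrite precompactE => F FF FA.
pose thick (Be : set X * R) :=
  A `&` [set x | exists2 y, Be.1 y & ball y Be.2 x].
pose G := filter_from [set Be : set X * R | F Be.1 /\ 0 < Be.2] thick.
have GF : ProperFilter G.
  apply: filter_from_proper.
    apply: filter_from_filter; first by exists (setT, 1); split=> //; exact: filterT.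
    move=> [B e] [C d] [/= FB e0] [/= FC d0].
    exists (B `&` C, Num.min e d) => /=.
      by split; [exact: filterI|rewrite lt_min e0].
    move=> x [Ax [y /= [By Cy] yx]]; split; split => //; exists y => //=.
      by apply: le_ball yx; rewrite ge_min lexx.
    by apply: le_ball yx; rewrite ge_min lexx orbT.
  move=> [B e] [/= FB e0].
  have [y [clAy By]] := filter_ex (filterI FA FB).
  have [x [Ax yx]] := clAy _ (nbhsx_ballx y e e0).
  by exists x; split => //; exists y.
have [U [UU GU]] := ultraFilterLemma GF.
have UA : U A.
  apply: GU; exists (setT, 1); first by split => //; exact: filterT.
  by move=> x [].
have [p Up] := Acvg U UU UA.
exists p; split; first by move=> V /Up UV; exact: filter_ex (filterI UA UV).
move=> B V FB /nbhs_ballP[e /= e0 eV].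
have e20 : 0 < e / 2 by rewrite divr_gt0.
have UB : U (thick (B, e / 2)) by apply: GU; exists (B, e / 2).
have Ue : U (ball p (e / 2)) by apply: Up; exact: nbhsx_ballx.
(* The point [x] is within [e / 2] of both the limit [p] and some [y] in [B], which makes [p] a
   cluster point of [F]. *)
have [x [[_ [y /= By yx]] px]] := filter_ex (filterI UB Ue).
exists y; split => //; apply: eV; rewrite [e]splitr.
by apply: ball_triangle px _; exact: ball_sym.
Qed.

(** One point of [D] is chosen in each rational interval that meets [D]; any open interval around a
    point [t] of [D] contains a rational one around [t]. *)
Lemma order_dense_sequence (R : realType) (D : set R) (t0 : R) : D t0 ->
  exists2 e : nat -> R, (forall n, D (e n)) & e 0%N = t0 /\
    forall a b t, D t -> a < t < b -> exists n, a < e n < b.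
Proof.
move=> Dt0.
have [f fD] : {f : rat * rat -> R & forall pq, D (f pq) /\
    forall t, D t -> ratr pq.1 < t < ratr pq.2 -> ratr pq.1 < f pq < ratr pq.2}.
  apply: (@choice _ _ (fun (pq : rat * rat) s => D s /\
    forall t, D t -> ratr pq.1 < t < ratr pq.2 -> ratr pq.1 < s < ratr pq.2)).
  move=> pq; have [[t [Dt tpq]]|npq] :=
      pselect (exists t, D t /\ ratr pq.1 < t < ratr pq.2); first by exists t.
  by exists t0; split => // t Dt tpq; exfalso; apply: npq; exists t.
(* Index 0 is reserved for [t0], hence the shift by one; [t0] also fills the indices that code no
   pair. *)
pose e n := if n is m.+1 then (if unpickle m is Some pq then f pq else t0) else t0.
exists e.
  by case=> [//|n] /=; case: unpickle => // pq; have [] := fD pq.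
split=> // a b t Dt /andP[at_ tb].
have [p /itvP ap] := rat_in_itvoo at_; have [q /itvP qb] := rat_in_itvoo tb.
exists (pickle (p, q)).+1; rewrite /e pickleK.
have [_ /(_ t Dt)] := fD (p, q); rewrite /= ap qb => /(_ isT) /andP[pf fq].
by rewrite (lt_trans _ pf) ?ap// (lt_trans fq)// qb.
Qed.

(** Metric form of closedness: nearby comparable pairs suffice, so they can be drawn from a filter
    without building sequences. *)
Lemma causal_le_closed (R : realType) (M : metricType R) (ell : M -> M -> \bar R)
    (x y : M) : closed [set p : M * M | causal_le ell p.1 p.2] ->
  (forall e, 0 < e -> exists x' y',
    [/\ mdist x x' < e, mdist y y' < e & causal_le ell x' y']) ->
  causal_le ell x y.
Proof.
move=> cl xy; apply: (cl (x, y)) => U /nbhs_ballP[e /= e0 eU].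
have [x' [y' [xx' yy' x'y']]] := xy e e0; exists (x', y'); split => //.
by apply: eU; split => /=; rewrite ballEmdist.
Qed.

(** * Left limits of a bounded causal map on a dense set of times *)

Section left_limits.
Context {R : realType} {M : metricType R} {ell : M -> M -> \bar R}.
Hypothesis Mfms : forward_metric_spacetime ell.
Hypothesis Mcomplete : complete_metric M.
Variables (E : set R) (h : R -> M) (b : M).
Hypothesis E0 : E 0.
Hypothesis Edense : forall s t, 0 <= s -> s < t -> t <= 1 ->
  exists2 r, E r & s < r < t.
Hypothesis h_causal : forall s t, E s -> E t -> s <= t -> causal_le ell (h s) (h t).
Hypothesis h_bounded : forall t, E t -> causal_le ell (h t) b.

(** Otherwise every point of [E] before [t] is followed by a jump of size at least [e] before [t].
    Iterating from 0 gives a causal sequence bounded by [b], whose convergence contradicts the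
    jumps. *)
Lemma left_oscillation t e : 0 < t -> 0 < e ->
  exists2 a, E a /\ a < t & forall s, E s -> a < s < t -> mdist (h a) (h s) < e.
Proof.
move=> t0 e0; apply: contrapT => nosc.
have step a : exists s, E a /\ a < t ->
    [/\ E s, a < s < t & e <= mdist (h a) (h s)].
  have [[Ea at_]|] := pselect (E a /\ a < t); last by exists 0.
  apply: contrapT => /forallNP ns; apply: nosc; exists a => // s Es ast.
  by rewrite ltNge; apply/negP => es; apply: (ns s).
have [nxt nxtP] := choice step.
pose v n := iter n nxt 0.
have vP n : E (v n) /\ v n < t.
  by elim: n => [//|n IH]; have [? /andP[] ] := nxtP _ IH.
have [n|n|l vl] := fms_forward Mfms (u := h \o v) (b := b).
- have [Es /andP[/ltW vs _] _] := nxtP _ (vP n).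
  by apply: h_causal => //; have [] := vP n.
- by apply: h_bounded; have [] := vP n.
have e20 : 0 < e / 2 by rewrite divr_gt0.
have /cvgrPdist_lt/(_ _ e20) [N _ vN] := vl.
have [_ _] := nxtP _ (vP N); apply/negP; rewrite -ltNge [e]splitr.
apply: le_lt_trans (metric_triangle _ l _) _.
rewrite ltrD// 1?metric_sym; first exact: vN (leqnn N).
by rewrite metric_sym; exact: vN (leqnSn N).
Qed.

Lemma left_limit_exists t : 0 < t <= 1 ->
  exists l, forall e, 0 < e -> exists2 a, a < t &
    forall s, E s -> a < s < t -> mdist (h s) l < e.
Proof.
move=> /andP[t0 t1].
pose F := filter_from [set a : R | a < t]
  (fun a => [set h s | s in [set s | E s /\ a < s < t]]).
have FF : ProperFilter F.
  apply: filter_from_proper.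
    apply: filter_from_filter; first by exists 0.
    move=> a c /= at_ c_t; exists (Num.max a c); first by rewrite /= gt_max at_.
    move=> y [s [Es /andP[]]]; rewrite gt_max => /andP[as_ cs] st <-.
    by split; exists s => //; split => //; apply/andP.
  move=> a /= at_; have [||r Er] := @Edense (Num.max 0 a) t _ _ t1.
  - by rewrite le_max lexx.
  - by rewrite gt_max t0.
  rewrite gt_max => /andP[/andP[_ ar] rt].
  by exists (h r), r => //; split => //; apply/andP.
(* Small oscillation says that [F] contains balls of every radius, so it is Cauchy. *)
have [l Fl] : exists l : M, F --> l.
  apply: Mcomplete; apply: cauchy_exP => e e0.
  have [a [Ea at_] ha] := left_oscillation t0 e0.
  exists (h a), a => // _ [s [Es ast] <-].
  by rewrite ballEmdist; exact: ha.
exists l => e e0.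
have [a at_ aF] : F (ball l e) by apply: Fl; exact: nbhsx_ballx.
exists a => // s Es ast; rewrite metric_sym.
have := aF (h s); rewrite ballEmdist; apply; by exists s.
Qed.

End left_limits.

(** * The path of left limits: causality, left continuity, countably many discontinuities *)

Section left_limit_path.
Context {R : realType} {M : metricType R} {ell : M -> M -> \bar R}.
Hypothesis Mfms : forward_metric_spacetime ell.
Variables (E : set R) (h G : R -> M).
Hypothesis E01 : forall t, E t -> 0 <= t <= 1.
Hypothesis E0 : E 0.
Hypothesis Edense : forall s t, 0 <= s -> s < t -> t <= 1 ->
  exists2 r, E r & s < r < t.
Hypothesis h_causal : forall s t, E s -> E t -> s <= t -> causal_le ell (h s) (h t).
Hypothesis G0 : G 0 = h 0.
Hypothesis Gleft : forall t, 0 < t <= 1 -> forall e, 0 < e -> exists2 a, a < t &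
    forall s, E s -> a < s < t -> mdist (h s) (G t) < e.

Lemma left_approx t c e : 0 < t <= 1 -> c < t -> 0 < e ->
  exists s, [/\ E s, c < s < t & mdist (h s) (G t) < e].
Proof.
move=> /[dup] t01 /andP[t0 t1] ct e0; have [a at_ aG] := Gleft t01 e0.
have [||r Er] := @Edense (Num.max 0 (Num.max a c)) t _ _ t1.
- by rewrite le_max lexx.
- by rewrite !gt_max t0 at_.
rewrite !gt_max -!andbA => /and4P[_ ar cr rt].
by exists r; split => //; [apply/andP|apply: aG => //; apply/andP].
Qed.

Lemma causal_le_left_limit s t : E s -> s < t -> t <= 1 -> causal_le ell (h s) (G t).
Proof.
move=> Es st t1; apply: (causal_le_closed (fms_closed Mfms)) => e e0.
have /andP[s0 _] := E01 Es.
have t01 : 0 < t <= 1 by rewrite (le_lt_trans s0).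
have [r [Er /andP[sr _] rG]] := left_approx t01 st e0.
exists (h s), (h r); split; rewrite ?mdistxx 1?metric_sym//.
exact: h_causal (ltW sr).
Qed.

Lemma left_limit_causal_le s t : E s -> 0 <= t -> t <= s -> causal_le ell (G t) (h s).
Proof.
move=> Es; rewrite le_eqVlt => /predU1P[<- s0|t0 ts].
  by rewrite G0; exact: h_causal.
apply: (causal_le_closed (fms_closed Mfms)) => e e0.
have /andP[s0 s1] := E01 Es.
have t01 : 0 < t <= 1 by rewrite t0 (le_trans ts).
have [r [Er /andP[_ rt] rG]] := left_approx t01 t0 e0.
exists (h r), (h s); split; rewrite ?mdistxx 1?metric_sym//.
exact: h_causal (le_trans (ltW rt) ts).
Qed.

(** A time [r] of [E] strictly between [s] and [t] interpolates: [G s] precedes [h r], which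
    precedes [G t]. *)
Lemma left_limit_path_causal s t : 0 <= s -> s <= t -> t <= 1 ->
  causal_le ell (G s) (G t).
Proof.
move=> s0; rewrite le_eqVlt => /predU1P[<- _|st t1]; first exact: fms_refl.
have [r Er /andP[sr rt]] := Edense s0 st t1.
apply: (fms_trans Mfms (y := h r)); first exact: left_limit_causal_le (ltW sr).
exact: causal_le_left_limit.
Qed.

Lemma left_limit_path_left t e : 0 < t <= 1 -> 0 < e ->
  exists2 a, a < t & forall s, 0 < s -> a < s < t -> mdist (G t) (G s) < e.
Proof.
move=> /[dup] t01 /andP[t0 t1] e0; have e20 : 0 < e / 2 by rewrite divr_gt0.
have [a at_ aG] := Gleft t01 e20; exists a => // s s0 /andP[as_ st].
have s01 : 0 < s <= 1 by rewrite s0 (le_trans (ltW st)).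
(* [G s] is itself a left limit, so it is close to some [h r] with [r] still in []a, t[], where [h]
   is close to [G t]. *)
have [r [Er /andP[ar rs] rG]] := left_approx s01 as_ e20.
rewrite [e]splitr (le_lt_trans (metric_triangle _ (h r) _))// ltrD//.
by rewrite metric_sym aG// ar (lt_trans rs).
Qed.

(** Two-sided failure of [h] to tend to [G t] along [E], at scale [e]. The time [s = t] is allowed,
    so a value [h t] far from [G t] counts too. *)
Definition discontinuity e t := 0 < t < 1 /\
  forall d, 0 < d -> exists s, [/\ E s, `|s - t| < d & e <= mdist (h s) (G t)].

(* A left limit exists at each point, so each discontinuity of size [e] has
   none of the same size just to its left. *)
Lemma countable_discontinuity e : 0 < e -> countable (discontinuity e).
Proof.
move=> e0; have e20 : 0 < e / 2 by rewrite divr_gt0.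
have [a aP] : {a : R -> R & forall t, 0 < t <= 1 -> 0 <= a t < t /\
    forall s, E s -> a t < s < t -> mdist (h s) (G t) < e / 2}.
  apply: (@choice _ _ (fun t a => 0 < t <= 1 -> 0 <= a < t /\
    forall s, E s -> a < s < t -> mdist (h s) (G t) < e / 2)) => t.
  have [t01|] := pselect (0 < t <= 1); last by exists 0.
  have [a at_ aG] := Gleft t01 e20; have /andP[t0 _] := t01.
  exists (Num.max 0 a) => /= _; rewrite le_max lexx gt_max t0 at_; split => // s Es.
  by rewrite gt_max -andbA => /and3P[_ as_ st]; apply: aG => //; apply/andP.
(* Countability follows from disjointness of nonempty open sets; outside []0, 1]] the unit interval
   is a dummy value. *)
pose B t := if pselect (0 < t <= 1) then `]a t, t[%classic else `]0, 1[%classic : set R.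
apply: (@separated_open_countable R R B) => [t|t|].
- by rewrite /B; case: pselect => t01; exact: interval_open.
- rewrite /B; case: pselect => t01.
    have [/andP[_ at_] _] := aP t t01.
    by exists ((a t + t) / 2); rewrite /= in_itv/= midf_lt//= midf_lt.
  by exists (1 / 2); rewrite /= in_itv /=; lra.
(* If the intervals overlapped, [s] would lie in []a t, t[], where [h] stays within [e / 2] of
   [G t]. Then [h r] at a jump near [s] and [h q] approximating [G s] are both that close to [G t],
   so [h r] is within [e] of [G s]. *)
have disj t s x : discontinuity e t -> discontinuity e s -> s < t -> B s x -> ~ B t x.
  move=> [/andP[t0 t1] dt] [/andP[s0 s1] ds] st.
  have t01 : 0 < t <= 1 by rewrite t0 ltW.
  have s01 : 0 < s <= 1 by rewrite s0 ltW.
  rewrite /B; case: pselect => // t01'; case: pselect => // s01' /=.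
  rewrite !in_itv/= => /andP[_ xs] /andP[ax _].
  have as_ : a t < s by exact: lt_trans ax xs.
  have [_ aG] := aP t t01.
  have d0 : 0 < Num.min (t - s) (s - a t) by rewrite lt_min !subr_gt0 st.
  have [r [Er]] := ds _ d0; rewrite lt_min ltr_norml [X in _ && X]ltr_norml.
  move=> /andP[/andP[_ rt] /andP[ar _]]; apply/negP; rewrite -ltNge.
  have hr : mdist (h r) (G t) < e / 2 by apply: aG => //; apply/andP; split; lra.
  (* This slack is the precision required of [h q], so that the three distances from [h r] to [G s]
     add up to less than [e]. *)
  have h0 : 0 < e / 2 - mdist (h r) (G t) by rewrite subr_gt0.
  have [q [Eq /andP[aq qs] qG]] := left_approx s01 as_ h0.
  have hq : mdist (h q) (G t) < e / 2 by apply: aG => //; rewrite aq (lt_trans qs).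
  have := metric_triangle (h r) (G t) (G s).
  have := metric_triangle (G t) (h q) (G s).
  by rewrite (metric_sym (G t) (h q)); lra.
move=> t s dt ds [x [Bt Bs]].
have [ts|st|//] := ltgtP t s.
  by have := disj s t x ds dt ts Bt.
by have := disj t s x dt ds st Bs.
Qed.

End left_limit_path.

(** * Pointwise convergence at the continuity times of the limit *)

Section pointwise_limit.
Context {R : realType} {M : metricType R} {ell : M -> M -> \bar R}.
Hypothesis Mfms : forward_metric_spacetime ell.
Variables (E : set R) (h G : R -> M) (u : nat -> R -> M) (t : R).
Hypothesis E01 : forall t, E t -> 0 <= t <= 1.
Hypothesis Edense : forall s t, 0 <= s -> s < t -> t <= 1 ->
  exists2 r, E r & s < r < t.
Hypothesis u_causal : forall n s t, 0 <= s -> s <= t -> t <= 1 ->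
  causal_le ell (u n s) (u n t).
Hypothesis u_cvg : forall s, E s -> u n s @[n --> \oo] --> h s.
Hypothesis t01 : 0 < t < 1.
Hypothesis t_continuous : forall e, 0 < e -> ~ discontinuity E h G e t.

Lemma two_sided_approx e : 0 < e -> exists s r,
  [/\ E s, E r, s < t, t < r & mdist (h s) (G t) < e /\ mdist (h r) (G t) < e].
Proof.
move=> e0; have /andP[t0 t1] := t01.
have [d d0 hd] : exists2 d, 0 < d &
    forall s, E s -> `|s - t| < d -> mdist (h s) (G t) < e.
  apply: contrapT => nd; apply: (t_continuous e0); split => // d d0.
  apply: contrapT => /forallNP ns; apply: nd; exists d => // s Es sd.
  by rewrite ltNge; apply/negP => es; exact: (ns s).
have [||s Es] := @Edense (Num.max 0 (t - d)) t _ _ (ltW t1).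
- by rewrite le_max lexx.
- by rewrite gt_max t0 ltrBlDr ltrDl.
rewrite gt_max -andbA => /and3P[s0 ds st].
have [||r Er] := @Edense t (Num.min 1 (t + d)) (ltW t0).
- by rewrite lt_min t1 ltrDl.
- by rewrite ge_min lexx.
rewrite lt_min => /and3P[tr r1 rd].
by exists s, r; split => //; split; apply: hd => //; rewrite ltr_norml;
  apply/andP; split; lra.
Qed.

(** At times [s < t < r] the paths eventually lie in a causally convex neighbourhood of [G t], which
    then traps their values at [t]. *)
Lemma pointwise_limit_convex : locally_causally_convex ell ->
  u n t @[n --> \oo] --> G t.
Proof.
move=> lcc W GW; have [V [GV VW cV]] := lcc _ _ GW.
have /nbhs_ballP[e /= e0 eV] := GV; have e20 : 0 < e / 2 by rewrite divr_gt0.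
have [s [r [Es Er st tr [sG rG]]]] := two_sided_approx e20.
have /andP[s0 _] := E01 Es; have /andP[_ r1] := E01 Er.
have near_V q : E q -> mdist (h q) (G t) < e / 2 -> \forall n \near \oo, V (u n q).
  move=> Eq qG; have /cvgrPdist_lt/(_ _ e20) := u_cvg Eq; apply: filterS => n qu.
  apply: eV; rewrite ballEmdist /= [e]splitr.
  by rewrite (le_lt_trans (metric_triangle _ (h q) _))// ltrD// metric_sym.
apply: filterS2 (near_V s Es sG) (near_V r Er rG) => n Vs Vr; apply: VW.
apply: cV Vs Vr _ _; apply: u_causal => //; rewrite ?ltW//; lra.
Qed.

(** Along an ultrafilter of indices at which [u n t] stays far from [G t], compactness gives a limit
    [y]. It is squeezed between values of [h] before and after [t], so antisymmetry forces
    [y = G t]. *)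
Lemma pointwise_limit_compact (K : set M) : compact K -> (forall n, K (u n t)) ->
  u n t @[n --> \oo] --> G t.
Proof.
move=> cK Ku; apply/cvgrPdist_lt => e e0; apply: contrapT => nfar.
pose far := [set n | ~ mdist (G t) (u n t) < e].
(* Failure of convergence means that [far] meets every tail of the indices. *)
have PW : ProperFilter (within far \oo).
  apply: Build_ProperFilter_ex => A WA; apply: contrapT => A0; apply: nfar.
  move: WA; rewrite /within /= => WA; apply: filterS WA => n farA.
  by apply: contrapT => /farA An; apply: A0; exists n.
have [U [UU WU]] := ultraFilterLemma PW.
have ooU (A : set nat) : (\forall n \near \oo, A n) -> U A.
  by move=> ooA; apply: WU; rewrite /within /=; apply: filterS ooA.
have Ufar : U far by apply: WU; exact: withinT.
have [|y _ uy] := ultra_cvg_compact (f := u ^~ t) UU cK.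
  by apply: filterE => n; exact: Ku.
have u_near s d : E s -> 0 < d -> \forall n \near U,
    mdist (h s) (u n s) < d /\ mdist y (u n t) < d.
  move=> Es d0; apply: filterS2 => [n||]; first exact: conj.
    by apply: ooU; have /cvgrPdist_lt := u_cvg Es; exact.
  by have /cvgrPdist_lt := uy; exact.
have hy s : E s -> s < t -> causal_le ell (h s) y.
  move=> Es st; apply: (causal_le_closed (fms_closed Mfms)) => d d0.
  have [n [sn yn]] := filter_ex (u_near s d Es d0).
  exists (u n s), (u n t); split => //; have /andP[s0 s1] := E01 Es.
  by apply: u_causal => //; rewrite ltW//; have /andP[] := t01.
have yh s : E s -> t < s -> causal_le ell y (h s).
  move=> Es ts; apply: (causal_le_closed (fms_closed Mfms)) => d d0.
  have [n [sn yn]] := filter_ex (u_near s d Es d0).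
  exists (u n t), (u n s); split => //; have /andP[s0 s1] := E01 Es.
  by apply: u_causal => //; rewrite ltW//; have /andP[] := t01.
have yG : y = G t.
  apply: (fms_antisym Mfms); apply: (causal_le_closed (fms_closed Mfms)) => d d0;
      have [s [r [Es Er st tr [sG rG]]]] := two_sided_approx d0.
    by exists y, (h r); rewrite mdistxx metric_sym; split => //; exact: yh.
  by exists (h s), y; rewrite mdistxx metric_sym; split => //; exact: hy.
have /cvgrPdist_lt/(_ _ e0) uU := uy.
have [n [fn nn]] := filter_ex (filterI Ufar uU).
by apply: fn; rewrite -yG.
Qed.

End pointwise_limit.

(** * From almost everywhere convergence to convergence in the integral distance *)

Section lcc_convergence.
Context {R : realType} {M : metricType R} {ell : M -> M -> \bar R}.
Context {Mbd : bounded_metric M}.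
Implicit Types g h : LCC ell Mbd.
Local Notation mu := (@lebesgue_measure R).

Lemma mdist_lipschitz (x y x' y' : M) :
  `|mdist x y - mdist x' y'| <= mdist x x' + mdist y y'.
Proof.
have := metric_triangle x x' y; have := metric_triangle x' y' y.
have := metric_triangle x' x y'; have := metric_triangle x y y'.
by rewrite (metric_sym x' x) (metric_sym y' y) ler_norml => *; lra.
Qed.

Lemma measurable_lcc_mdist g h :
  measurable_fun setT (fun t : R => mdist (g (clamp t)) (h (clamp t))).
Proof.
apply: left_continuous_measurable => t; apply/(@cvgrPdist_lt _ R^o) => e e0.
have e20 : 0 < e / 2 by rewrite divr_gt0.
have /cvgrPdist_lt/(_ _ e20) := @lcc_clamp_left _ _ _ _ h t.
have /cvgrPdist_lt/(_ _ e20) := @lcc_clamp_left _ _ _ _ g t.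
apply: filterS2 => s gs hs; rewrite /mdist/= distrC.
by rewrite (le_lt_trans (mdist_lipschitz _ _ _ _))// [e]splitr ltrD.
Qed.

(** Dominated convergence, the bound of the metric being the dominating constant. Time 0 is a
    separate assumption because the distance charges it separately. *)
Lemma lcc_cvg (u : nat -> LCC ell Mbd) g :
  u n (clamp 0) @[n --> \oo] --> g (clamp 0) ->
  {ae mu, forall t, `[0, 1]%classic t ->
    u n (clamp t) @[n --> \oo] --> g (clamp t)} ->
  u n @[n --> \oo] --> g.
Proof.
move=> u0 ut.
have [C Cbd] := Mbd.
pose f n t : \bar R := (mdist (g (clamp t)) (u n (clamp t)))%:E.
pose I := `[0, 1]%classic : set (measurableTypeR R).
have mI : measurable I by exact: measurable_itv.
have mf n : measurable_fun I (f n).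
  by apply/measurable_EFinP; apply: measurable_funTS; exact: measurable_lcc_mdist.
have [|||_ _ fcvg] := @dominated_convergence _ _ _ mu I mI
    f (cst 0%E) (cst C%:E) mf (measurable_cst _).
- apply: (@filterS _ _ (ae_filter_ringOfSetsType mu) _ _ _ ut) => t {}ut t01.
  apply/cvg_EFin; first by apply: nearW.
  apply/(@cvgrPdist_lt _ R^o) => e e0.
  have /cvgrPdist_lt/(_ _ e0) := ut t01; apply: filterS => n.
  by rewrite /mdist/= subr0 ger0_norm// mdist_ge0.
- apply: (measurable_bounded_integrable (f := cst C)) => //.
    by rewrite /I /= lebesgue_measure_itv/= lte_fin ltr01 -EFinD ltry.
  exact: bounded_cst.
- by apply: nearW => t n _; rewrite lee_fin /= ger0_norm ?mdist_ge0.
move: fcvg; rewrite integral0 => /fine_cvg fcvg.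
apply/cvgrPdist_lt => e e0; have e20 : 0 < e / 2 by rewrite divr_gt0.
have /(@cvgrPdist_lt _ R^o)/(_ _ e20) := fcvg.
have /cvgrPdist_lt/(_ _ e20) := u0.
apply: filterS2 => n n0 nf; rewrite [e]splitr ltrD//.
by apply: le_lt_trans nf; rewrite /mdist /= subr0 ler_norm.
Qed.

End lcc_convergence.

(** * Relative compactness for an order-dense set of times *)

Section lcc_compactness.
Context {R : realType} {M : metricType R} {ell : M -> M -> \bar R}.
Context {Mbd : bounded_metric M}.
Hypothesis Mfms : forward_metric_spacetime ell.
Hypothesis Mcomplete : complete_metric M.
Variables (Gamma : set (LCC ell Mbd)) (D : set R) (K : set M).
Hypothesis D01 : D `<=` `[0, 1].
Hypothesis D0 : D 0.
Hypothesis Ddense : forall s t, 0 <= s -> s < t -> t <= 1 ->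
  exists2 r, D r & s < r < t.
Hypothesis Gamma_precompact : forall t, D t ->
  precompact [set g (clamp t) | g in Gamma].
Hypothesis Kcompact : compact K.
Hypothesis Gamma_bounded :
  forall g, Gamma g -> exists2 x, K x & causal_le ell (g (clamp 1)) x.
Local Notation mu := (@lebesgue_measure R).

Lemma lcc_causal_clamp (g : LCC ell Mbd) s t : 0 <= s -> s <= t -> t <= 1 ->
  causal_le ell (g (clamp s)) (g (clamp t)).
Proof.
move=> s0 st t1; apply: lcc_causal.
by rewrite !clampK ?s0 ?t1 ?andbT//= ?(le_trans s0)// (le_trans st).
Qed.

Lemma lcc_ultra_cvg_eval (F : set_system (LCC ell Mbd)) t : UltraFilter F ->
  F Gamma -> D t -> exists y : M, (fun g : LCC ell Mbd => g (clamp t)) @ F --> y.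
Proof.
move=> FU FGamma Dt; have [C GC [cC _]] := Gamma_precompact Dt.
have [|y _ Fy] := ultra_cvg_compact (f := fun g : LCC ell Mbd => g (clamp t)) FU cC.
  by apply: filterS FGamma => g Gg; apply: GC; exists g.
by exists y.
Qed.

(** Each path of [Gamma] gets a point of [K] above its endpoint; the limit [b] of these points along
    [F] dominates the limits at all times at once. *)
Lemma lcc_ultra_bounded (F : set_system (LCC ell Mbd)) : UltraFilter F ->
  F Gamma -> exists b, forall t (y : M), 0 <= t <= 1 ->
    (fun g : LCC ell Mbd => g (clamp t)) @ F --> y -> causal_le ell y b.
Proof.
move=> FU FGamma.
have [x xP] : {x : LCC ell Mbd -> M & forall g, Gamma g ->
    K (x g) /\ causal_le ell (g (clamp 1)) (x g)}.
  apply: (@choice _ _ (fun (g : LCC ell Mbd) x => Gamma g ->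
    K x /\ causal_le ell (g (clamp 1)) x)) => g.
  have [/Gamma_bounded[y Ky gy]|] := pselect (Gamma g); first by exists y.
  by exists (g (clamp 1)).
have [|b _ xb] := ultra_cvg_compact (f := x) FU Kcompact.
  by apply: filterS FGamma => g /xP[].
exists b => t y /andP[t0 t1] Fy.
apply: (causal_le_closed (fms_closed Mfms)) => d d0.
have /cvgrPdist_lt/(_ _ d0) yd := Fy; have /cvgrPdist_lt/(_ _ d0) bd := xb.
have [g [Gg [yg bg]]] := filter_ex (filterI FGamma (filterI yd bd)).
exists (g (clamp t)), (x g); split => //.
apply: (fms_trans Mfms (y := g (clamp 1))); first exact: lcc_causal_clamp.
by have [] := xP g Gg.
Qed.

(** Common core of both cases: the disjunction only decides how convergence at a continuity time is
    obtained. *)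
Lemma precompact_lcc :
  locally_causally_convex ell \/ mu.-negligible (`[0, 1] `\` D) ->
  precompact Gamma.
Proof.
move=> lcc_or_full; apply: precompact_ultra => F FU FGamma.
have [g0 _] := filter_ex FGamma.
have [b Fb] := lcc_ultra_bounded FU FGamma.
have [e eD [e0 eE]] := order_dense_sequence D0.
pose E := range e.
have E01 t : E t -> 0 <= t <= 1.
  by move=> [n _ <-]; have := D01 (eD n); rewrite /= in_itv.
have E0 : E 0 by exists 0%N.
have Edense s t : 0 <= s -> s < t -> t <= 1 -> exists2 r, E r & s < r < t.
  move=> s0 st t1; have [r Dr srt] := Ddense s0 st t1.
  by have [n snt] := eE s t r Dr srt; exists (e n) => //; exists n.
have [h hP] : {h : R -> M & forall t, E t ->
    (fun g : LCC ell Mbd => g (clamp t)) @ F --> h t}.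
  apply: (@choice _ _ (fun t (y : M) => E t ->
    (fun g : LCC ell Mbd => g (clamp t)) @ F --> y)) => t.
  have [Et|] := pselect (E t); last by exists (g0 (clamp 0)).
  have [|y Fy] := @lcc_ultra_cvg_eval F t FU FGamma; last by exists y.
  by have [n _ <-] := Et.
have h_causal s t : E s -> E t -> s <= t -> causal_le ell (h s) (h t).
  move=> Es Et st; apply: (causal_le_closed (fms_closed Mfms)) => d d0.
  have /cvgrPdist_lt/(_ _ d0) sd := hP s Es.
  have /cvgrPdist_lt/(_ _ d0) td := hP t Et.
  have [g [sg tg]] := filter_ex (filterI sd td).
  exists (g (clamp s)), (g (clamp t)); split => //.
  have /andP[s0 _] := E01 _ Es; have /andP[_ t1] := E01 _ Et.
  exact: lcc_causal_clamp.
have h_bounded t : E t -> causal_le ell (h t) b.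
  by move=> Et; apply: Fb (hP t Et); exact: E01.
(* At time 0 there is no left limit, so the value is taken from [h]. *)
have [G GP] : {G : R -> M & forall t, (t = 0 -> G t = h 0) /\
    (0 < t <= 1 -> forall d, 0 < d -> exists2 a, a < t &
      forall s, E s -> a < s < t -> mdist (h s) (G t) < d)}.
  apply: (@choice _ _ (fun t l => (t = 0 -> l = h 0) /\
    (0 < t <= 1 -> forall d, 0 < d -> exists2 a, a < t &
      forall s, E s -> a < s < t -> mdist (h s) l < d))) => t.
  have [t01|] := pselect (0 < t <= 1); last by exists (h 0).
  have [l hl] := left_limit_exists Mfms Mcomplete E0 Edense h_causal h_bounded t01.
  by exists l; split => // t0; move: t01; rewrite t0 ltxx.
have G0 : G 0 = h 0 by apply: (GP 0).1.
have Gleft t : 0 < t <= 1 -> forall d, 0 < d -> exists2 a, a < t &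
  forall s, E s -> a < s < t -> mdist (h s) (G t) < d by exact: (GP t).2.
have g_causal (s t : I01 R) : \val s <= \val t ->
    causal_le ell (G (\val s)) (G (\val t)).
  case: s t => [s /= /andP[s0 _]] [t /= /andP[_ t1]] st.
  exact: (left_limit_path_causal Mfms E01 E0 Edense h_causal G0 Gleft).
have g_left (t : I01 R) : 0 < \val t ->
    G (\val (clamp s)) @[s --> (\val t)^'-] --> G (\val t).
  case: t => [t /= /andP[_ t1]] t0; apply/cvgrPdist_lt => d d0.
  have [|a at_ aG] := left_limit_path_left Edense Gleft _ d0 (t := t).
    by rewrite t0.
  near=> s; have s0 : 0 < s by near: s; exact: nbhs_left_gt.
  have st : s < t by near: s; exact: nbhs_left_lt.
  rewrite -[Num.max _ _]/(\val (clamp s)) clampK; last by rewrite !ltW// (lt_le_trans st).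
  by apply: aG => //; rewrite st andbT; near: s; exact: nbhs_left_gt.
pose g : LCC ell Mbd := @MkLCC R M ell Mbd (fun t => G (\val t)) g_causal g_left.
have gE t : 0 <= t <= 1 -> g (clamp t) = G t.
  by move=> t01; rewrite /g/= -[in RHS](clampK t01).
(* Dominated convergence fails for ultrafilters; a neighborhood of [g] outside
   of [F] instead provides a sequence converging to [h] on [E] but not to [g]. *)
exists g; apply/fcvgrPdist_lt => d d0; apply: contrapT => Fd.
have near_h m : F [set f : LCC ell Mbd | forall k, (k <= m)%N ->
    mdist (h (e k)) (f (clamp (e k))) < m.+1%:R^-1].
  (* The number [j] of evaluations is separated from [m], so that the induction keeps the tolerance
     fixed. *)
  suff near_le j : F [set f : LCC ell Mbd | forall k, (k <= j)%N ->
    mdist (h (e k)) (f (clamp (e k))) < m.+1%:R^-1] by [].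
  have near1 k : F [set f : LCC ell Mbd |
      mdist (h (e k)) (f (clamp (e k))) < m.+1%:R^-1].
    by have /cvgrPdist_lt := hP (e k) (ex_intro2 _ _ k I erefl); apply.
  elim: j => [|j IH].
    by apply: filterS (near1 0%N) => f f0 k; rewrite leqn0 => /eqP ->.
  apply: filterS2 IH (near1 j.+1) => f fj fj1 k.
  by rewrite leq_eqVlt ltnS => /predU1P[->//|]; exact: fj.
(* If no such path existed for some [m], the [d]-ball around [g] would contain a set of [F], against
   [Fd]. *)
have [u uP] : {u : nat -> LCC ell Mbd & forall m, [/\ Gamma (u m),
    forall k, (k <= m)%N -> mdist (h (e k)) (u m (clamp (e k))) < m.+1%:R^-1
    & ~ mdist g (u m) < d]}.
  apply: (@choice _ _ (fun m f => [/\ Gamma f,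
    forall k, (k <= m)%N -> mdist (h (e k)) (f (clamp (e k))) < m.+1%:R^-1
    & ~ mdist g f < d])) => m; apply: contrapT => /forallNP nf; apply: Fd.
  apply: filterS2 FGamma (near_h m) => f Gf hf.
  by apply: contrapT => fd; apply: (nf f).
have u_cvg s : E s -> u n (clamp s) @[n --> \oo] --> h s.
  move=> [k _ <-]; apply/cvgrPdist_lt => c c0; near=> n.
  have [_ /(_ k) un _] := uP n; apply: lt_trans (un _) _.
    by near: n; exact: nbhs_infty_ge.
  by near: n; exact: near_infty_natSinv_lt (PosNum c0).
have u_causal n s t : 0 <= s -> s <= t -> t <= 1 ->
  causal_le ell (u n (clamp s)) (u n (clamp t)) by exact: lcc_causal_clamp.
suff : u n @[n --> \oo] --> g.
  move=> /cvgrPdist_lt/(_ _ d0) ug; have [n] := filter_ex ug.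
  by have [_ _] := uP n.
apply: lcc_cvg; first by rewrite gE ?lexx ?ler01// G0; exact: u_cvg.
(* The endpoints are added because [discontinuity] only concerns interior times; the scales
   [n.+1%:R^-1] capture every positive one. *)
pose bad := [set 0; 1] `|` \bigcup_n discontinuity E h G n.+1%:R^-1.
have bad0 : mu.-negligible bad.
  have neg A : countable A -> mu.-negligible A.
    move=> cA; exists A; split => //; last exact: countable_lebesgue_measure0.
    exact: countable_measurable.
  apply: negligibleU; apply: neg; first exact: finite_set_countable.
  by apply: bigcup_countable => // n _; exact: (countable_discontinuity Edense Gleft).
have good t : 0 <= t <= 1 -> ~ bad t ->
    [/\ 0 < t < 1 & forall c, 0 < c -> ~ discontinuity E h G c t].
  move=> /andP[t0 t1] nbad; split.
    rewrite !lt_neqAle t0 t1 !andbT; apply/andP; split; apply/eqP => t_; apply: nbad.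
      by left; left.
    by left; right.
  move=> c c0 [t01 dt]; apply: nbad; right.
  near \oo => n; exists n => //; split => // r r0.
  have [s [Es sr cs]] := dt r r0; exists s; split => //; apply: le_trans cs.
  by apply: ltW; near: n; exact: near_infty_natSinv_lt (PosNum c0).
(* [N] collects the times without an argument for convergence: none under local causal convexity,
   otherwise those outside [D]. *)
suff [N N0 Nu] : exists2 N, mu.-negligible N &
    forall t, 0 <= t <= 1 -> ~ bad t -> ~ N t ->
      u n (clamp t) @[n --> \oo] --> G t.
  apply: negligibleS (negligibleU bad0 N0) => t /= /not_implyP[].
  rewrite in_itv /= => t01 tu.
  have [?|nbad] := pselect (bad t); first by left.
  right; apply: contrapT => nN; apply: tu.
  by have := Nu t t01 nbad nN; rewrite -(gE t t01).
case: lcc_or_full => [Mlcc|DN].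
  exists set0; first exact: negligible_set0.
  move=> t t01 nbad _; have [t01' tc] := good t t01 nbad.
  exact: (pointwise_limit_convex (u := fun n t => u n (clamp t))
    E01 Edense u_causal u_cvg t01' tc).
exists (`[0, 1] `\` D) => // t t01 nbad Dt; have [t01' tc] := good t t01 nbad.
have {}Dt : D t by apply: contrapT => nDt; apply: Dt; split => //=; rewrite in_itv.
have [C GC [cC _]] := Gamma_precompact Dt.
apply: (pointwise_limit_compact (u := fun n t => u n (clamp t))
  Mfms E01 Edense u_causal u_cvg t01' tc cC).
by move=> n; apply: GC; exists (u n) => //; have [] := uP n.
Unshelve. all: by end_near. Qed.

End lcc_compactness.

(** * Order density from full measure or topological density *)

Section dense_subsets_of_unit_interval.
Context {R : realType}.
Implicit Types D : set R.
Local Notation mu := (@lebesgue_measure R).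

Lemma full_measure_negligibleC D : measurable D -> D `<=` `[0, 1] ->
  mu D = 1%E -> mu.-negligible (`[0, 1] `\` D).
Proof.
move=> mD D01 D1; exists (`[0, 1]%classic `\` D); split => //.
  exact: measurableD.
have itv1 : mu `[0, 1]%classic = 1%E.
  by rewrite lebesgue_measure_itv/= lte_fin ltr01 oppr0 adde0.
rewrite measureD//; last by rewrite [ltLHS]itv1 ltry.
by rewrite (setIidr D01) [X in (X - _)%E]itv1 [X in (_ - X)%E]D1 subee.
Qed.

(** An interval []s, t[] missing [D] would lie in a null set while having positive length. *)
Lemma negligibleC_dense D s t : mu.-negligible (`[0, 1] `\` D) ->
  0 <= s -> s < t -> t <= 1 -> exists2 r, D r & s < r < t.
Proof.
move=> [N [mN N0 DN]] s0 st t1; apply: contrapT => nr.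
have : (mu `]s, t[%classic <= mu N)%E.
  apply: le_measure; rewrite ?inE// => r /=; rewrite in_itv/= => /andP[sr rt].
  apply: DN; split.
    by rewrite /= in_itv/= !ltW// ?(le_lt_trans s0)// (lt_le_trans rt).
  by move=> Dr; apply: nr; exists r => //; rewrite sr.
rewrite N0 lebesgue_measure_itv/= lte_fin st -EFinD lee_fin.
by rewrite leNgt subr_gt0 st.
Qed.

Lemma closure_order_dense D s t : `[0, 1] `<=` closure D ->
  0 <= s -> s < t -> t <= 1 -> exists2 r, D r & s < r < t.
Proof.
move=> clD s0 st t1; have /andP[sm mt] : s < (s + t) / 2 < t by rewrite !midf_lt.
(* The midpoint lies in the closure of [D], and []s, t[] is one of its neighbourhoods. *)
have /clD/(_ `]s, t[%classic) : `[0, 1]%classic ((s + t) / 2).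
  by rewrite /= in_itv/= (le_trans s0 (ltW sm)) (le_trans (ltW mt)).
case=> [|r [Dr /=]]; last by rewrite in_itv; exists r.
by apply: open_nbhs_nbhs; split; [exact: interval_open|rewrite /= in_itv/= sm].
Qed.

End dense_subsets_of_unit_interval.

Theorem theorem2p30 (R : realType) (M : metricType R) (ell : M -> M -> \bar R)
    (Mfms : forward_metric_spacetime ell)
    (Mcomplete : complete_metric M) (Mbd : bounded_metric M) :
  (forall Gamma : set (LCC ell Mbd),
     (exists D : set R,
        [/\ measurable D, D `<=` `[0, 1], lebesgue_measure D = 1%E, D 0
          & forall t, D t -> precompact [set g (clamp t) | g in Gamma]]) ->
     (exists2 K : set M, compact K &
        forall g, Gamma g -> exists2 x, K x & causal_le ell (g (clamp 1)) x) ->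
     precompact Gamma)
  /\
  (locally_causally_convex ell ->
   forall Gamma : set (LCC ell Mbd),
     (exists D : set R,
        [/\ D `<=` `[0, 1], `[0, 1] `<=` closure D, D 0
          & forall t, D t -> precompact [set g (clamp t) | g in Gamma]]) ->
     (exists2 K : set M, compact K &
        forall g, Gamma g -> exists2 x, K x & causal_le ell (g (clamp 1)) x) ->
     precompact Gamma).
Proof.
split=> [Gamma [D [mD D01 D1 D0 Dpre]]|lcc Gamma [D [D01 clD D0 Dpre]]] [K cK Kub].
(* Full measure serves twice: for order density of [D], and for compactness of the values at almost
   every time. *)
- have DN := full_measure_negligibleC mD D01 D1.
  apply: (precompact_lcc Mfms Mcomplete D01 D0 _ Dpre cK Kub); last by right.
  by move=> s t; exact: negligibleC_dense.
- apply: (precompact_lcc Mfms Mcomplete D01 D0 _ Dpre cK Kub); last by left.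
  by move=> s t; exact: closure_order_dense.
Qed.
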